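(* Let $\theta>0$ and let $X$ be a real random variable. If $\|X\|_{\varphi_\theta}<\infty$, then $$\mathrm{P}\{|X|>t\}\le2\exp\left\{-\frac{t^\theta}{2\|X\|_{\varphi_\theta}^\theta}\right\}\quad\text{for all }t\ge0.$$
   Context: For $\theta>0$, $\|X\|_{\varphi_\theta}:=\sup_{k\ge1}\left(\mathrm{E}|X|^{\theta k}/k!\right)^{1/(\theta k)}$ (supremum over positive integers $k$). *)

(* Defs.v *)
From mathcomp Require Import all_boot all_order all_algebra.
From mathcomp Require Import all_classical all_reals all_analysis.

Set Implicit Arguments.
Unset Strict Implicit.
Unset Printing Implicit Defensive.

Import Order.TTheory GRing.Theory Num.Theory.
Import numFieldNormedType.Exports.

Local Open Scope classical_set_scope.
Local Open Scope ring_scope.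
Local Open Scope ereal_scope.

(* The moments and the supremum are taken in [\bar R], so that an infinite
   moment gives the value +oo. *)
Definition phi_norm (d : measure_display) (T : measurableType d)
    (R : realType) (P : probability T R) (theta : R) (X : T -> R) : \bar R :=
  ereal_sup [set ('E_P[fun w => (`|X w| `^ (theta * k%:R))%R] / (k`!%:R)%:E)
                   `^ ((theta * k%:R)^-1)%R | k in [set k : nat | (0 < k)%N]].

(* Main.v *)
(* The moment bounds E|X|^(theta k) <= k! N^(theta k), with N the norm of X,
   give E exp(|X|^theta / (2 N^theta)) <= \sum_k 2^-k = 2, and Markov's
   inequality concludes. Markov's inequality is applied to the partial sums of
   the exponential series, so that expectations are only exchanged with finite
   sums. *)
Require Import Defs.
From mathcomp Require Import all_boot all_order all_algebra.
From mathcomp Require Import all_classical all_reals all_analysis.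
From mathcomp Require Import measurable_realfun ring.

Import Order.TTheory GRing.Theory Num.Theory.
Import numFieldNormedType.Exports.

Local Open Scope classical_set_scope.
Local Open Scope ring_scope.
Local Open Scope ereal_scope.

Lemma phi_norm_ge0 {d : measure_display} {T : measurableType d} {R : realType}
    (P : probability T R) (theta : R) (X : T -> R) : 0 <= phi_norm P theta X.
Proof.
(* The supremum dominates its member at k = 1, a power and so nonnegative. *)
apply: (@le_trans _ _ (('E_P[fun w => (`|X w| `^ (theta * 1%:R))%R] /
  (1`!%:R)%:E) `^ ((theta * 1%:R)^-1)%R)); first exact: poweR_ge0.
by apply: ereal_sup_ubound; exists 1%N.
Qed.

Lemma moment_le_phi_norm {d : measure_display} {T : measurableType d}
    {R : realType} (P : probability T R) (theta : R) (X : T -> R) (k : nat) :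
  (0 < theta)%R ->
  'E_P[fun w => (`|X w| `^ (theta * k%:R))%R] <=
    (k`!%:R)%:E * phi_norm P theta X `^ (theta * k%:R).
Proof.
move=> theta0; have [->|k0] := posnP k.
  (* Index 0 lies outside the supremum. Every power with exponent 0 is 1, even that of [+oo], and
     [P] has mass 1, so both sides are 1. *)
  rewrite mulr0 poweRe0 mule1 fact0.
  under [X in 'E_P[X]]funext do rewrite powRr0.
  by rewrite expectation_cst.
have tk0 : (0 < theta * k%:R)%R by rewrite mulr_gt0 ?ltr0n.
set E := 'E_P[_].
have E0 : 0 <= E by apply: expectation_ge0 => w; exact: powR_ge0.
have f0 : (0 < k`!%:R :> R)%R by rewrite ltr0n fact_gt0.
rewrite -lee_pdivrMl// muleC.
have EfE : E / (k`!%:R)%:E = E * ((k`!%:R)^-1)%:E by rewrite inver gt_eqF.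
rewrite -EfE.
have Ef0 : 0 <= E / (k`!%:R)%:E by rewrite EfE mule_ge0// lee_fin invr_ge0 ltW.
(* Writing the quotient as a power of its own root exhibits the k-th member of the supremum; raising
   to a positive power is monotone on [0, +oo]. *)
have -> : E / (k`!%:R)%:E =
    ((E / (k`!%:R)%:E) `^ (theta * k%:R)^-1) `^ (theta * k%:R).
  by rewrite -poweRrM mulVf ?lt0r_neq0// poweRe1.
apply: (gt0_ler_poweR (ltW tk0)).
- by rewrite in_itv/= poweR_ge0 leey.
- by rewrite in_itv/= phi_norm_ge0 leey.
- by apply: ereal_sup_ubound; exists k.
Qed.

Lemma measurable_normr_gt {d : measure_display} {T : measurableType d}
    {R : realType} (X : {mfun T >-> R}) (t : R) :
  measurable [set w | (t < `|X w|)%R].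
Proof.
have mX : measurable_fun setT (fun w => (`|X w|%R : R)%:E).
  by apply/measurable_EFinP; exact: measurableT_comp.
rewrite -[X in measurable X]setTI.
exact: (emeasurable_fun_o_infty measurableT mX t%:E).
Qed.

(** [markov] bounds the larger event t <= |X|; since f t >= 0, monotonicity of the measure passes to
    the strict event. *)
Lemma markov_gt {d : measure_display} {T : measurableType d} {R : realType}
    {P : probability T R} (X : {RV P >-> R}) (f : R -> R) (t : R) :
  (0 < t)%R -> measurable_fun setT f -> (forall r, 0 <= r -> 0 <= f r)%R ->
  {in Num.nneg &, {homo f : x y / x <= y}}%R ->
  (f t)%:E * P [set w | (t < `|X w|)%R] <= 'E_P[fun w => f `|X w|%R].
Proof.
move=> t0 mf f0 fnd; apply: le_trans (markov X t0 mf f0 fnd).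
apply: lee_pmul => //; first by rewrite lee_fin f0// ltW.
have mX : measurable_fun setT (fun w => (`|X w|%R : R)%:E).
  by apply/measurable_EFinP; exact: measurableT_comp.
apply: le_measure; rewrite ?inE.
- exact: measurable_normr_gt.
- rewrite -[X in measurable X]setTI.
  exact: (emeasurable_fun_c_infty measurableT mX t%:E).
- by move=> w /= /ltW.
Qed.

Section partial_exponential.
Context {R : realType} (theta b : R) (theta0 : (0 < theta)%R) (b0 : (0 < b)%R).

(** The parameter [b] stands for N^theta when the norm N is positive. *)
Definition partial_expR (n : nat) (r : R) : R :=
  series (exp_coeff (r `^ theta / (2 * b))%R) n.

(** In this form only the moments of order theta k enter the expectation, and the coefficients are
    visibly nonnegative, which gives monotonicity on r >= 0. *)
Lemma partial_expRE (n : nat) (r : R) : (partial_expR n r =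
  \sum_(k < n) (k`!%:R^-1 * (2 * b)^-1 ^+ k * r `^ (theta * k%:R)))%R.
Proof.
rewrite /partial_expR /series/= big_mkord; apply: eq_bigr => k _.
by rewrite exp_coeffE exprMn powRrM powR_mulrn ?powR_ge0// mulrCA mulrC.
Qed.

Lemma measurable_partial_expR (n : nat) : measurable_fun setT (partial_expR n).
Proof.
rewrite (funext (partial_expRE n)).
apply: measurable_sum => k.
by apply: measurable_funM => //; exact: measurable_powR.
Qed.

Lemma partial_expR_coef_ge0 (k : nat) :
  (0 <= k`!%:R^-1 * (2 * b)^-1 ^+ k :> R)%R.
Proof.
by rewrite mulr_ge0 ?invr_ge0// exprn_ge0// invr_ge0 mulr_ge0// ltW.
Qed.

Lemma partial_expR_ge0 (n : nat) (r : R) : (0 <= partial_expR n r)%R.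
Proof.
rewrite partial_expRE sumr_ge0// => k _.
by rewrite mulr_ge0 ?partial_expR_coef_ge0 ?powR_ge0.
Qed.

Lemma partial_expR_homo (n : nat) :
  {in Num.nneg &, {homo partial_expR n : x y / x <= y}}%R.
Proof.
move=> x y x0 y0 xy; rewrite !partial_expRE; apply: ler_sum => k _.
rewrite ler_wpM2l ?partial_expR_coef_ge0//.
by rewrite ge0_ler_powR// mulr_ge0// ltW.
Qed.

End partial_exponential.

(** The coefficient 1 / (k! (2b)^k) times the moment bound k! b^k leaves 2^-k: the 2 in 2b creates
    the geometric series, whose sum is the constant 2. *)
Lemma expectation_partial_expR_le2 {d : measure_display} {T : measurableType d}
    {R : realType} {P : probability T R} {theta b : R} (X : {RV P >-> R}) :
  (0 < theta)%R -> (0 < b)%R ->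
  (forall k : nat, 'E_P[fun w => (`|X w| `^ (theta * k%:R))%R] <=
    (k`!%:R * b ^+ k)%:E) ->
  forall n : nat, 'E_P[fun w => partial_expR theta b n `|X w|%R] <= 2%:E.
Proof.
move=> theta0 b0 moment n.
have mX k : measurable_fun setT (fun w => (`|X w| `^ (theta * k%:R))%R).
  apply: (measurableT_comp (measurable_powR (theta * k%:R))).
  exact: measurableT_comp.
rewrite unlock.
under eq_integral do rewrite partial_expRE -sumEFin.
rewrite ge0_integral_sum//; last 2 first.
- move=> k; apply/measurable_EFinP; exact: measurable_funM.
- move=> k w _; rewrite lee_fin mulr_ge0 ?powR_ge0//.
  exact: partial_expR_coef_ge0.
apply: (@le_trans _ _ (\sum_(k < n) (2^-1 ^+ k)%:E)).
  apply: lee_sum => k _.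
  under eq_integral do rewrite EFinM.
  rewrite ge0_integralZl_EFin//; last 2 first.
  - exact/measurable_EFinP.
  - exact: partial_expR_coef_ge0.
  have c0 : 0 <= (k`!%:R^-1 * (2 * b)^-1 ^+ k)%:E.
    by rewrite lee_fin partial_expR_coef_ge0.
  move: (moment k); rewrite unlock => /(lee_wpmul2l c0) /le_trans; apply.
  rewrite -EFinM lee_fin invfM exprMn [leLHS](_ : _ =
    2^-1 ^+ k * ((b^-1 * b) ^+ k) * (k`!%:R^-1 * k`!%:R))%R; last first.
    by rewrite exprMn; ring.
  by rewrite mulVf ?gt_eqF// expr1n mulr1 mulVf ?mulr1// pnatr_eq0 -lt0n fact_gt0.
rewrite sumEFin lee_fin.
have -> : (\sum_(k < n) 2^-1 ^+ k = 2 - 2 * 2^-1 ^+ n :> R)%R.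
  elim: n => [|n IH]; first by rewrite big_ord0 expr0 mulr1 subrr.
  by rewrite big_ord_recr/= IH exprS; field.
by rewrite lerBlDr lerDl mulr_ge0// exprn_ge0.
Qed.

(** Markov's inequality for [partial_expR theta b n] gives a bound by 2 uniform in n, so it survives
    the passage from partial sums to the exponential. *)
Lemma tail_le_of_moment_le {d : measure_display} {T : measurableType d}
    {R : realType} {P : probability T R} {theta b : R} (X : {RV P >-> R}) :
  (0 < theta)%R -> (0 < b)%R ->
  (forall k : nat, 'E_P[fun w => (`|X w| `^ (theta * k%:R))%R] <=
    (k`!%:R * b ^+ k)%:E) ->
  forall t : R, (0 < t)%R ->
  P [set w | (t < `|X w|)%R] <= (2 * expR (- (t `^ theta / (2 * b))))%:E.
Proof.
move=> theta0 b0 moment t t0.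
set A := [set w | _].
have PA : P A \is a fin_num by apply: fin_num_measure; exact: measurable_normr_gt.
rewrite -(fineK PA) lee_fin expRN ler_pdivlMr ?expR_gt0//.
set p := fine (P A).
have p0 : (0 <= p)%R by exact: fine_ge0.
have le2 n : (p * partial_expR theta b n t <= 2)%R.
  rewrite -lee_fin mulrC EFinM fineK//.
  apply: le_trans (expectation_partial_expR_le2 X theta0 b0 moment n).
  apply: (markov_gt X (partial_expR theta b n) t) => //.
  - exact: measurable_partial_expR.
  - by move=> r _; exact: partial_expR_ge0.
  - exact: partial_expR_homo.
(* A null event is settled first, so that dividing by [p] can isolate the partial sums, all at most
   2 / p; [expR] is their limit. *)
have [p_eq0|pN0] := eqVneq p 0%R; first by rewrite p_eq0 mul0r.
have pgt0 : (0 < p)%R by rewrite lt_def pN0.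
rewrite -ler_pdivlMl//.
apply: limr_le; first exact: is_cvg_series_exp_coeff.
by apply: nearW => n; rewrite ler_pdivlMl//; exact: le2.
Qed.

(* Division is that of [\bar R], where [0^-1 = +oo]: if [phi_norm P theta X = 0],
   the right-hand side is [0] for [0 < t] and [2] for [t = 0]. *)
Theorem corollary6 (d : measure_display) (T : measurableType d) (R : realType)
    (P : probability T R) (theta : R) (X : {RV P >-> R}) :
  (0 < theta)%R ->
  phi_norm P theta X < +oo ->
  forall t : R, (0 <= t)%R ->
  P [set w | (t < `|X w|)%R] <=
    2%:E * expeR (- ((t `^ theta)%:E / (2%:E * phi_norm P theta X `^ theta))).
Proof.
move=> theta0 Nfin t; rewrite le_eqVlt => /predU1P[<-|t0].
  rewrite powR0 ?gt_eqF// mul0e oppe0 expeR0 mule1.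
  by apply: le_trans (probability_le1 _ (measurable_normr_gt _ _)) _; rewrite ?lee_fin ?ler1n//.
have := fun k => moment_le_phi_norm P theta X k theta0.
have := phi_norm_ge0 P theta X.
case: (phi_norm P theta X) Nfin => [N _| |]//.
rewrite lee_fin le_eqVlt => /predU1P[<-|N0] moment.
  (* For norm 0 there is no admissible [b]. The moment bound at k = 1 makes E|X|^theta vanish, and
     Markov's inequality for r^theta shows that the event is null. *)
  have : (t `^ theta)%:E * P [set w | (t < `|X w|)%R] <= 0.
    have := moment 1%N.
    rewrite mulr1 poweR0r ?gt_eqF// mule0; apply: le_trans.
    apply: (markov_gt X (fun r => r `^ theta)%R t) => //.
    - by move=> r _; exact: powR_ge0.
    - by move=> x y x0 y0 xy; rewrite ge0_ler_powR// ltW.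
  rewrite pmule_rle0 ?lte_fin ?powR_gt0// => /le_trans; apply.
  by rewrite mule_ge0// expeR_ge0.
have a0 : (0 < 2 * N `^ theta)%R by rewrite mulr_gt0 ?powR_gt0.
rewrite poweR_EFin -EFinM inver (gt_eqF a0)/=.
(* Here b = N^theta, and N^(theta k) = b^k turns the moment bounds into the required form. *)
apply: tail_le_of_moment_le => //; first exact: powR_gt0.
move=> k; apply: le_trans (moment k) _.
by rewrite poweR_EFin -EFinM powRrM powR_mulrn ?powR_ge0.
Qed.
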